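(* Let $\Omega$ be a finite ground set, $f:2^\Omega\to\mathbb{R}_{\ge0}$ a (possibly nonmonotone) submodular function, $\rho$ a routing-based cost function on $2^\Omega$ with minimum visiting cost $c_{\min}$, $\mathbf{c}>0$ a budget, and $\hat\rho$ a $(1+\theta)$-approximation algorithm for $\rho$ with $0<\theta\le c_{\min}/\mathbf{c}$. Fix $S\subseteq\Omega$. Let $X^{\rho}$ be the output of the greedy loop on $S$ with evaluator $\rho$ and budget $\mathbf{c}$, and $X^{\hat\rho}$ the output of the greedy loop on $S$ with evaluator $\hat\rho$ and budget $(1+\theta)\mathbf{c}$. Then $|X^{\hat\rho}\setminus X^{\rho}|\le 1$.
   Context: $f$ submodular: $f(A\cup B)+f(A\cap B)\le f(A)+f(B)$; $f^+_A(x)=f(A\cup\{x\})-f(A)$. Routing-based cost function: items of $\Omega$ are vertices of a weighted graph with visiting costs $c_s\ge0$ and positive edge weights, $\rho(S')=\sum_{s\in S'}c_s+r^*(S')$ with $r^*(S')$ the minimum cost of a route traversing each vertex of $S'$ at least once; $\rho(\emptyset)=0$, $\rho$ nondecreasing; $c_{\min}=\min\{c_s:s\in\Omega\}$, and $\rho(T\cup\{s\})-\rho(T)\ge c_{\min}$ for all $T\subseteq\Omega$, $s\notin T$. $\hat\rho$ satisfies $\rho(S')\le\hat\rho(S')\le(1+\theta)\rho(S')$ for all $S'$. Greedy loop on $S$ with evaluator $C$ and budget $B$: start with empty sequence $X$ and $R=S$; while $R\ne\emptyset$, let $s^*=\arg\max\{f^+_X(s):s\in R\}$ (fixed tie-breaking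 independent of $C$); if $C(X\cup\{s^*\})\le B$ append $s^*$ to $X$ and remove it from $R$, else stop; output the final $X$. *)

(* Defs.v *)
From HB Require Import structures.
From mathcomp Require Import all_boot all_order all_algebra.
From mathcomp Require Import boolp classical_sets reals.

Set Implicit Arguments.
Unset Strict Implicit.
Unset Printing Implicit Defensive.

Import Order.TTheory GRing.Theory Num.Theory.
Local Open Scope ring_scope.

Section SetFunctions.
Variables (R : realType) (Omega : finType).
Implicit Types (f : {set Omega} -> R) (A B : {set Omega}).

Definition submodular f :=
  forall A B, f (A :|: B) + f (A :&: B) <= f A + f B.

Definition marginal f A (x : Omega) : R := f (x |: A) - f A.

End SetFunctions.

(* Finite undirected graph; [weight] is meaningful on edges only. *)
Record wgraph (R : realType) (V : finType) := WGraph {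
  adj : rel V;
  weight : V -> V -> R;
  adj_sym : symmetric adj;
  adj_irr : irreflexive adj;
  weight_sym : forall x y, adj x y -> weight x y = weight y x;
  weight_gt0 : forall x y, adj x y -> 0 < weight x y }.

Section Routing.
Variables (R : realType) (V Omega : finType) (G : wgraph R V).
Variable loc : Omega -> V. (* the vertex that each item is *)

(* A route is a walk, given by the sequence of its vertices (repetitions are
   allowed; the empty route has cost 0). With [tour := true] it must moreover
   return to its starting vertex. *)
Definition is_route (tour : bool) (p : seq V) : bool :=
  if p is x :: q then path (adj G) x q && (tour ==> (last x q == x)) else true.

Definition route_cost (p : seq V) : R :=
  \sum_(a <- zip p (behead p)) weight G a.1 a.2.

Definition covering_route tour (S : {set Omega}) (p : seq V) : bool :=
  is_route tour p && [forall s in S, loc s \in p].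

(* The infimum is a minimum as soon as items are mutually reachable:
   see [opt_route_cost_min]. *)
Definition opt_route_cost tour (S : {set Omega}) : R :=
  inf [set route_cost p | p in [set p | covering_route tour S p]]%classic.

Definition items_connected :=
  forall s t : Omega, connect (adj G) (loc s) (loc t).

Definition routing_cost tour (c : Omega -> R) (S : {set Omega}) : R :=
  \sum_(s in S) c s + opt_route_cost tour S.

Lemma route_cost_cons x y q :
  route_cost [:: x, y & q] = weight G x y + route_cost (y :: q).
Proof. by rewrite /route_cost /= big_cons. Qed.

Lemma exists_covering_route tour S :
  items_connected -> exists p, covering_route tour S p.
Proof.
move=> conn; have [->|[s0 _]] := set_0Vmem S.
  by exists [::]; apply/forall_inP => s; rewrite inE.
suff [q [pq lq qS]] : exists q, [/\ path (adj G) (loc s0) q,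
    last (loc s0) q = loc s0 & forall s, s \in enum S -> loc s \in loc s0 :: q].
  exists (loc s0 :: q); rewrite /covering_route /= pq lq eqxx implybT /=.
  by apply/forall_inP => s sS; apply: qS; rewrite mem_enum.
elim: (enum S) => [|t l [q [pq lq qS]]]; first by exists [::].
have /connectP[p1 pp1 lp1] := conn s0 t.
have /connectP[p2 pp2 lp2] := conn t s0.
exists (p1 ++ p2 ++ q); split.
- by rewrite !cat_path pp1 -lp1 pp2 -lp2.
- by rewrite !last_cat -lp1 -lp2.
move=> s; rewrite inE => /orP[/eqP->|/qS].
  by rewrite -cat_cons mem_cat lp1 mem_last.
by rewrite !inE !mem_cat => /orP[->//|->]; rewrite !orbT.
Qed.

Lemma opt_route_cost_min tour S : items_connected ->
  exists p, [/\ covering_route tour S p, route_cost p = opt_route_cost tour S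
    & forall q, covering_route tour S q -> route_cost p <= route_cost q].
Proof.
move=> /(exists_covering_route tour S)[p0 cp0].
pose d : R := \big[Order.min/1]_(a : V * V | adj G a.1 a.2) weight G a.1 a.2.
have d0 : 0 < d.
  rewrite /d; elim/big_ind: _ => // [x y x0 y0|a]; first by rewrite lt_min x0.
  exact: weight_gt0.
have cost_ge p : is_route tour p -> d * (size p).-1%:R <= route_cost p.
  case: p => [_|x q /andP[+ _]]; first by rewrite mulr0 /route_cost big_nil.
  elim: q x => [x _|y q IH x] /=; first by rewrite mulr0 /route_cost big_nil.
  move=> /andP[xy /IH le]; rewrite route_cost_cons -natr1 mulrDr mulr1 addrC.
  by apply: lerD => //; apply: (bigmin_le_cond _ (j := (x, y))).
have [N KN] : exists N : nat, route_cost p0 < d * N%:R.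
  exists (Num.bound `|route_cost p0 / d|).
  rewrite mulrC -ltr_pdivrMr //; apply: le_lt_trans (ler_norm _) _.
  exact: archi_boundP (normr_ge0 _).
have short p : covering_route tour S p -> route_cost p <= route_cost p0 ->
    (size p <= N)%N.
  move=> /andP[rp _] le; have := le_lt_trans (le_trans (cost_ge p rp) le) KN.
  by rewrite ltr_pM2l // ltr_nat; case: (size p).
pose b0 : N.-bseq V := Bseq (short p0 cp0 (lexx _)).
have cb0 : covering_route tour S (val b0) by [].
case: (arg_minP (P := fun b : N.-bseq V => covering_route tour S (val b))
  (fun b => route_cost (val b)) cb0) => b cb bmin.
have bmin' q : covering_route tour S q -> route_cost b <= route_cost q.
  move=> cq; have [le|/ltW le] := leP (route_cost q) (route_cost p0).
    exact: (bmin (Bseq (short q cq le))).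
  exact: le_trans (bmin b0 cb0) le.
exists b; split=> //; apply/eqP; rewrite eq_le; apply/andP; split.
  apply: lb_le_inf; first by exists (route_cost b); exists (val b).
  by move=> _ [q cq <-]; exact: bmin'.
apply: ge_inf; last by exists (val b).
by exists (route_cost b) => _ [q cq <-]; exact: bmin'.
Qed.

End Routing.

(* The minimum of [c] over the nonempty type [Omega]; it does not depend on the
   witness [s0] of nonemptiness. *)
Definition cmin (R : realType) (Omega : finType) (s0 : Omega) (c : Omega -> R)
  : R := \big[Order.min/c s0]_(s : Omega) c s.

Definition approximates (R : realType) (Omega : finType) (theta : R)
    (rho rhohat : {set Omega} -> R) :=
  forall S, rho S <= rhohat S /\ rhohat S <= (1 + theta) * rho S.

Section Greedy.
Variables (R : realType) (Omega : finType) (f : {set Omega} -> R).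

(* [sel X Q] is the argmax chosen among the remaining items [Q] when the
   current sequence is [X]; being an argument of the loop, the tie-breaking it
   embodies cannot depend on the evaluator. *)
Definition argmax_rule (sel : seq Omega -> {set Omega} -> Omega) :=
  forall (X : seq Omega) (Q : {set Omega}), Q != finset.set0 ->
    sel X Q \in Q /\
    forall s, s \in Q ->
      marginal f [set x in X] s <= marginal f [set x in X] (sel X Q).

Variables (sel : seq Omega -> {set Omega} -> Omega).
Variables (C : {set Omega} -> R) (B : R).

(* [n] is fuel; [finset.set0] is qualified because classical_sets shadows it. *)
Fixpoint greedy_loop (n : nat) (X : seq Omega) (Q : {set Omega}) : seq Omega :=
  if n is n'.+1 then
    if Q == finset.set0 then X else
    let s := sel X Q in
    if C (s |: [set x in X]) <= B then greedy_loop n' (rcons X s) (Q :\ s)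
    else X
  else X.

(* Each iteration removes an item, so [#|S|] of them always suffice. *)
Definition greedy (S : {set Omega}) : seq Omega := greedy_loop #|S| [::] S.

End Greedy.

(* Main.v *)
(* If the exact loop accepts an item, so does the approximate one, as
   rhohat <= (1 + theta) rho.  Hence the two runs agree until the exact loop
   rejects an item s at some X with rho (X + s) > budget.  If the approximate
   loop accepts s, any further item s' costs at least cmin >= theta * budget, so
   rhohat (X + s + s') >= rho (X + s) + cmin > (1 + theta) * budget and the
   approximate loop stops. *)

Require Import Defs.
From HB Require Import structures.
From mathcomp Require Import all_boot all_order all_algebra.
From mathcomp Require Import boolp classical_sets reals.

Set Implicit Arguments.
Unset Strict Implicit.
Unset Printing Implicit Defensive.

Import Order.TTheory GRing.Theory Num.Theory.
Local Open Scope ring_scope.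

(** An optimal route for [T] also covers [S], so it competes in the minimum for [S]. *)
Lemma opt_route_cost_subset (R : realType) (V Omega : finType) (G : wgraph R V)
    (loc : Omega -> V) (tour : bool) (S T : {set Omega}) :
  items_connected G loc -> S \subset T ->
  opt_route_cost G loc tour S <= opt_route_cost G loc tour T.
Proof.
move=> conn ST.
have [p [_ <- pmin]] := opt_route_cost_min tour S conn.
have [q [/andP[rq /forall_inP qT] <- _]] := opt_route_cost_min tour T conn.
apply: pmin; rewrite /covering_route rq /=.
by apply/forall_inP => s sS; apply: qT; apply: (fintype.subsetP ST).
Qed.

Lemma routing_cost_setU1_ge (R : realType) (V Omega : finType) (G : wgraph R V)
    (loc : Omega -> V) (tour : bool) (c : Omega -> R) (s0 s : Omega)
    (T : {set Omega}) :
  items_connected G loc -> s \notin T ->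
  routing_cost G loc tour c T + cmin s0 c <= routing_cost G loc tour c (s |: T).
Proof.
move=> conn sT; rewrite /routing_cost big_setU1 //= addrAC.
apply: lerD; last exact/opt_route_cost_subset/finset.subsetUr.
by rewrite addrC lerD2r; apply: bigmin_le_cond.
Qed.

(** Costs enter only through the two implications between [C] and [D]. Both loops start from an
    arbitrary common state, so that induction on the fuel absorbs their shared prefix. *)
Lemma card_greedy_loop_setD_le1 (R : realType) (Omega : finType)
    (sel : seq Omega -> {set Omega} -> Omega) (C D : {set Omega} -> R)
    (b d : R) (n : nat) (X : seq Omega) (Q : {set Omega}) :
  (forall X (Q : {set Omega}), Q != finset.set0 -> sel X Q \in Q) ->
  (forall A, C A <= b -> D A <= d) ->
  (forall (A : {set Omega}) s, s \notin A -> b < C A -> d < D (s |: A)) ->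
  {in Q, forall x, x \notin X} ->
  (#|[set x in greedy_loop sel D d n X Q] :\:
     [set x in greedy_loop sel C b n X Q]| <= 1)%N.
Proof.
move=> selQ CD CDlt; elim: n X Q => [|n IH] X Q QX /=.
  by rewrite finset.setDv cards0.
case: ifPn => [_|Q0]; first by rewrite finset.setDv cards0.
set s := sel X Q.
have rconsE : [set x in rcons X s] = s |: [set x in X].
  by apply/setP => x; rewrite !inE mem_rcons inE.
have QX' : {in Q :\ s, forall x, x \notin rcons X s}.
  by move=> x /setD1P[xs xQ]; rewrite mem_rcons inE negb_or xs QX.
(* If [C] accepts [s], so does [D], and the loops again share a state. *)
have [Cb|bC] := leP (C (s |: [set x in X])) b; first by rewrite (CD _ Cb) IH.
case: ifP => _; last by rewrite finset.setDv cards0.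
(* Either fuel or items have run out, or the next item is new to [rcons X s], whose [C]-cost exceeds
   [b], and [D] rejects it. *)
have -> : greedy_loop sel D d n (rcons X s) (Q :\ s) = rcons X s.
  case: n {IH} => //= n; case: ifPn => // Qs0.
  rewrite ifF // rconsE; apply/negbTE; rewrite -ltNge; apply: CDlt => //.
  by rewrite -rconsE inE QX' // selQ.
rewrite rconsE -(cards1 s); apply/subset_leq_card/fintype.subsetP => x.
by rewrite !inE => /andP[/negbTE->]; rewrite orbF.
Qed.

Theorem theorem5 (R : realType) (Omega : finType) (s0 : Omega)
    (f : {set Omega} -> R)
    (f_ge0 : forall A, 0 <= f A) (f_submod : submodular f)
    (V : finType) (G : wgraph R V) (loc : Omega -> V) (loc_inj : injective loc)
    (G_conn : items_connected G loc) (tour : bool)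
    (c : Omega -> R) (c_ge0 : forall s, 0 <= c s)
    (budget : R) (budget_gt0 : 0 < budget)
    (theta : R) (theta_gt0 : 0 < theta) (theta_le : theta <= cmin s0 c / budget)
    (rhohat : {set Omega} -> R)
    (rhohat_approx : approximates theta (routing_cost G loc tour c) rhohat)
    (sel : seq Omega -> {set Omega} -> Omega)
    (sel_argmax : argmax_rule f sel)
    (S : {set Omega}) :
  let Xrho := greedy sel (routing_cost G loc tour c) budget S in
  let Xhat := greedy sel rhohat ((1 + theta) * budget) S in
  (#|[set x in Xhat] :\: [set x in Xrho]| <= 1)%N.
Proof.
apply: card_greedy_loop_setD_le1 => [X Q Q0|A rA|A s sA ltA|x _]; last by [].
- by have [] := sel_argmax X Q Q0.
- apply: le_trans (rhohat_approx A).2 _.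
  by rewrite ler_wpM2l // addr_ge0 // ltW.
- apply: lt_le_trans (rhohat_approx _).1.
  apply: lt_le_trans (routing_cost_setU1_ge tour c s0 G_conn sA).
  (* Split [(1 + theta) * budget] as [budget + theta * budget]: the first term is below the cost of
     [A], the second at most [cmin s0 c] by [theta_le]. *)
  by rewrite mulrDl mul1r ltr_leD // -ler_pdivlMr.
Qed.
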